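(* (1) Let $(X,\|\cdot\|)$ be a real normed space with dual $X^*$. Assume that $A:X\to 2^{X^*}$ is monotone and $B:X\to 2^{X^*}$ is uniformly monotone (with some pre-modulus $\widetilde{\mu}$). If, in addition, $(A+B)^{-1}$ is single-valued, then $(A+B)^{-1}:X^*\to X$ is continuous. (2) In particular, suppose that $(X,\|\cdot\|)$ is a real reflexive Banach space, $A:X\to 2^{X^*}$ is maximally monotone, $\lambda>0$, and $f:X\to\mathbb{R}$ is fully Legendre and has the property that $\nabla f$ is uniformly monotone of power type $\rho>1$. Then $(\nabla f+\lambda A)^{-1}$ is Hölder continuous with exponent $1/(\rho-1)$. Moreover, if, in addition, $\nabla f$ is continuous, then $\mathrm{Res}^f_{\lambda A}$ is continuous.
   Context: A set-valued operator $A:X\to 2^{X^*}$ is monotone if $\langle x_1^*-x_2^*,x_1-x_2\rangle\ge 0$ whenever $x_1^*\in Ax_1$, $x_2^*\in Ax_2$ (with $\langle x^*,x\rangle=x^*(x)$); it is maximally monotone if its graph is not properly contained in the graph of another monotone operator. An operator $B:X\to 2^{X^*}$ is uniformly monotone with modulus $\mu$ and pre-modulus $\widetilde{\mu}$ if $\langle u_1-u_2,y_1-y_2\rangle\ge\mu(\|y_1-y_2\|)$ for all $y_1,y_2\in X$, $u_1\in By_1$, $u_2\in By_2$, where $\mu:[0,\infty)\to[0,\infty)$ has the form $\mu(t)=t\widetilde{\mu}(t)$ and $\widetilde{\mu}:[0,\infty)\to[0,\infty)$ is increasing and invertible (a bijection of $[0,\infty)$). $B$ is uniformly monotone of power type $\rho$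 if $\rho>1$ and there is $\beta>0$ such that this holds with $\mu(t)=\beta t^{\rho}$. For $B:X\to 2^{X^*}$, $B^{-1}:X^*\to 2^X$ is $B^{-1}(w)=\{x\in X:w\in Bx\}$; sums of sets are Minkowski sums (empty if one summand is empty), $(A+B)x=Ax+Bx$, $(\lambda A)(x)=\lambda A(x)$. An operator is single-valued if every point of its source space has exactly one image; the value is then identified with that element. A function $f:X\to(-\infty,\infty]$ on a real reflexive Banach space is fully Legendre if it is lower semicontinuous, convex and Gâteaux differentiable (hence finite) on all of $X$, and its convex conjugate $f^*(x^* )=\sup\{\langle x^*,x\rangle-f(x):x\in X\}$ is Gâteaux differentiable (hence finite) on all of $X^*$. The resolvent of $\lambda A$ relative to $f$ is $\mathrm{Res}^f_{\lambda A}(x)=(\nabla f+\lambda A)^{-1}(\nabla f(x))$, $x\in X$. Under the assumptions of (2), $(\nabla f+\lambda A)^{-1}$ and $\mathrm{Res}^f_{\lambda A}$ are single-valued. A map $T:X^*\to X$ is Hölder continuous with exponent $\alpha>0$ if there is $C\geq 0$ with $\|Tw_1-Tw_2\|\le C\|w_1-w_2\|^{\alpha}$ for all $w_1,w_2\in X^*$. Continuity is with respect to the norm topologies. *)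

(* Defs.v *)
From HB Require Import structures.
From mathcomp Require Import all_boot all_order all_algebra.
From mathcomp Require Import all_classical all_reals all_analysis.
Set Implicit Arguments.
Unset Strict Implicit.
Unset Printing Implicit Defensive.
Import Order.TTheory GRing.Theory Num.Theory.
Import numFieldNormedType.Exports.
Local Open Scope classical_set_scope.
Local Open Scope ring_scope.

Definition continuous_linear (R : realType) (X : normedModType R) :
    {pred X -> R} :=
  mem [set p : X -> R | linear p /\ continuous p].
Arguments continuous_linear {R} X.

Record dual (R : realType) (X : normedModType R) := Dual {
  dual_fun :> X -> R;
  _ : dual_fun \in continuous_linear X }.

Section dual_normedModType.
Context {R : realType} {X : normedModType R}.
Implicit Types p q : dual X.

HB.instance Definition _ := [isSub for @dual_fun R X].
HB.instance Definition _ := gen_eqMixin (dual X).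
HB.instance Definition _ := gen_choiceMixin (dual X).

Lemma continuous_linear_submod_closed : submod_closed (continuous_linear X).
Proof.
split.
- rewrite inE; split; last exact: cst_continuous.
  by move=> a x y; rewrite /= scaler0 addr0.
- move=> a p q; rewrite !inE => -[lp cp] [lq cq]; split.
    move=> b x y; rewrite !fctE lp lq !scalerDr.
    by rewrite !scalerA (mulrC a b) addrACA.
  by move=> x; apply: cvgD; [apply: cvgZr; exact: cp|exact: cq].
Qed.

HB.instance Definition _ := GRing.isSubmodClosed.Build R (X -> R)
  (continuous_linear X) continuous_linear_submod_closed.
HB.instance Definition _ := [SubChoice_isSubLmodule of dual X by <:].

Lemma dual_linear p : linear p.
Proof. by case: p => p /=; rewrite inE => -[]. Qed.

Lemma dual_continuous p : continuous p.
Proof. by case: p => p /=; rewrite inE => -[]. Qed.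

HB.instance Definition _ p := GRing.isLinear.Build R X R _ p (dual_linear p).

Lemma dualDE p q x : (p + q) x = p x + q x. Proof. by []. Qed.

Lemma dualZE (a : R) p x : (a *: p) x = a * p x. Proof. by []. Qed.

Definition dual_norm p : R := sup [set `|p x| | x in [set x | `|x| <= 1]].

Lemma dual_norm_has_sup p : has_sup [set `|p x| | x in [set x | `|x| <= 1]].
Proof.
split; first by exists `|p 0|; exists 0 => //=; rewrite normr0.
have /linear_boundedP/pinfty_ex_gt0 [M M0 Mp] :=
  continuous_linear_bounded 0 (@dual_continuous p 0).
exists M => _ [x /= x1 <-]; apply: (le_trans (Mp x)).
by rewrite -[leRHS]mulr1 ler_wpM2l// ltW.
Qed.

Lemma ler_dual_norm p x : `|p x| <= dual_norm p * `|x|.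
Proof.
have [->|x0] := eqVneq x 0; first by rewrite linear0 !normr0 mulr0.
rewrite -ler_pdivrMr ?normr_gt0//.
apply: ub_le_sup; first by have [] := dual_norm_has_sup p.
exists (`|x|^-1 *: x) => /=.
  by rewrite normrZ normfV normr_id mulVf ?normr_eq0.
by rewrite linearZ/= normrM normfV normr_id mulrC.
Qed.

Lemma dual_norm_le p (M : R) :
  (forall x, `|x| <= 1 -> `|p x| <= M) -> dual_norm p <= M.
Proof.
move=> pM; apply: ge_sup; first by have [] := dual_norm_has_sup p.
by move=> _ [x x1 <-]; exact: pM.
Qed.

Lemma ler_dual_norm1 p x : `|x| <= 1 -> `|p x| <= dual_norm p.
Proof.
move=> x1; apply: ub_le_sup; first by have [] := dual_norm_has_sup p.
by exists x.
Qed.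

Lemma dual_norm_ge0 p : 0 <= dual_norm p.
Proof. by rewrite (le_trans _ (@ler_dual_norm1 p 0 _))// normr0. Qed.

Lemma dual_normD p q : dual_norm (p + q) <= dual_norm p + dual_norm q.
Proof.
apply: dual_norm_le => x x1; rewrite dualDE (le_trans (ler_normD _ _))//.
by rewrite lerD// ler_dual_norm1.
Qed.

Lemma dual_normZ (a : R) p : dual_norm (a *: p) = `|a| * dual_norm p.
Proof.
have le b q : dual_norm (b *: q) <= `|b| * dual_norm q.
  apply: dual_norm_le => x x1; rewrite dualZE normrM.
  by rewrite ler_wpM2l// ler_dual_norm1.
apply/eqP; rewrite eq_le le/=.
have [->|a0] := eqVneq a 0; first by rewrite normr0 mul0r dual_norm_ge0.
rewrite mulrC -ler_pdivlMr ?normr_gt0// mulrC -normfV.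
by rewrite -{1}(scale1r p) -(mulVf a0) -scalerA le.
Qed.

Lemma dual_norm0_eq0 p : dual_norm p = 0 -> p = 0.
Proof.
move=> p0; apply/val_inj/funext => x /=; apply/eqP; rewrite -normr_le0.
by rewrite (le_trans (ler_dual_norm p x))// p0 mul0r.
Qed.

HB.instance Definition _ := Lmodule_isNormed.Build R (dual X)
  dual_normD dual_normZ dual_norm0_eq0.

End dual_normedModType.

(* Surjectivity of the canonical embedding x |-> (p |-> p x) into the bidual. *)
Definition reflexive_space (R : realType) (X : normedModType R) :=
  forall F : dual (dual X), exists x : X, forall p : dual X, F p = p x.

Section set_valued_maps.
Context {R : realType}.

Definition op_inv {U V : Type} (F : U -> set V) : V -> set U :=
  fun v => [set u | F u v].

Definition op_add {U : Type} {V : zmodType} (F G : U -> set V) : U -> set V :=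
  fun x => [set u + v | u in F x & v in G x].

Definition op_scale {U : Type} {V : lmodType R} (a : R) (F : U -> set V) :
    U -> set V :=
  fun x => [set a *: u | u in F x].

Definition op_fun {U V : Type} (g : U -> V) : U -> set V := fun x => [set g x].

Definition single_valued {U V : Type} (F : U -> set V) :=
  forall u, exists! v, F u v.

Definition hoelder_continuous {U V : normedModType R} (alpha : R)
    (T : U -> V) :=
  0 < alpha /\ exists2 C : R, 0 <= C &
    forall w1 w2, `|T w1 - T w2| <= C * `|w1 - w2| `^ alpha.

(* Continuity and Hoelder continuity of a set-valued map include the claim
   that it is single-valued; they are asserted of the map of its values. *)
Definition op_continuous {U V : normedModType R} (F : U -> set V) :=
  exists2 T : U -> V, F = op_fun T & continuous T.

Definition op_hoelder_continuous {U V : normedModType R} (alpha : R)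
    (F : U -> set V) :=
  exists2 T : U -> V, F = op_fun T & hoelder_continuous alpha T.

End set_valued_maps.

Section monotone_operators.
Context {R : realType} {X : normedModType R}.
Implicit Types A B : X -> set (dual X).

Definition op_graph A : set (X * dual X) := [set z | A z.1 z.2].

Definition monotone_op A := forall (x1 x2 : X) (p1 p2 : dual X),
  A x1 p1 -> A x2 p2 -> 0 <= (p1 - p2) (x1 - x2).

Definition maximally_monotone A := monotone_op A /\
  forall A', monotone_op A' -> ~ (op_graph A `<` op_graph A').

(* Functions on [0, +oo[ are represented by functions on R, of which only the
   values on [0, +oo[ are constrained or used. *)
Definition premodulus (mut : R -> R) :=
  {in `[0, +oo[ &, {homo mut : s t / s < t}} /\
  set_bij `[0, +oo[%classic `[0, +oo[%classic mut.

Definition uniformly_monotone_with (mu mut : R -> R) B :=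
  [/\ premodulus mut, (forall t, 0 <= t -> mu t = t * mut t) &
    forall (y1 y2 : X) (u1 u2 : dual X), B y1 u1 -> B y2 u2 ->
      mu `|y1 - y2| <= (u1 - u2) (y1 - y2)].

Definition uniformly_monotone B :=
  exists mu mut, uniformly_monotone_with mu mut B.

Definition uniformly_monotone_power (rho : R) B :=
  1 < rho /\ exists2 beta : R, 0 < beta &
    exists mut, uniformly_monotone_with (fun t => beta * t `^ rho) mut B.

End monotone_operators.

Section legendre.
Context {R : realType}.

Definition gateaux_derivative {V : normedModType R} (f : V -> R) (x : V)
    (p : dual V) :=
  forall h : V, is_derive x h f (p h).

Definition gateaux_differentiable {V : normedModType R} (f : V -> R) :=
  forall x, exists p, gateaux_derivative f x p.

Definition gradient {V : normedModType R} (f : V -> R) (x : V) : dual V :=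
  xget 0 [set p | gateaux_derivative f x p].

Definition conjugate {X : normedModType R} (f : X -> R) (p : dual X) : \bar R :=
  ereal_sup [set (p x - f x)%:E | x in [set: X]].

(* f is real-valued from the start, since a fully Legendre function is finite
   everywhere. *)
Definition fully_legendre {X : normedModType R} (f : X -> R) :=
  [/\ lower_semicontinuous (EFin \o f),
      convex_function [set: convex_lmodType X] f,
      gateaux_differentiable f,
      (forall p, conjugate f p \is a fin_num) &
      gateaux_differentiable (fine \o conjugate f)].

Definition resolvent {X : normedModType R} (f : X -> R)
    (A : X -> set (dual X)) : X -> set X :=
  fun x => op_inv (op_add (op_fun (gradient f)) A) (gradient f x).

End legendre.

(* Main.v *)
From HB Require Import structures.
Require Import Defs.
From mathcomp Require Import all_boot all_order all_algebra.
From mathcomp Require Import all_classical all_reals all_analysis.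
From mathcomp Require Import ring lra.

(* If C is uniformly monotone with modulus t * mut t, then
   mut |x1 - x2| <= |w1 - w2| whenever w1 is in C x1 and w2 in C x2, so C^-1 has
   at most one value at each point and inherits a modulus of continuity.

   What remains is the surjectivity of grad f + lambda A, i.e. a zero of
   grad f + B for the translate B := lambda A - w. Write g for the conjugate of
   f. The Fitzpatrick function of B dominates the pairing (x, p) |-> p x, and
   f x + g (- p) >= - p x, so the algebraic Hahn-Banach theorem separates it
   from - (f x + g (- p)) by an affine function on the product of X and its
   dual. This function is continuous, because f is bounded above on a ball by
   Baire's theorem, and so is g because the uniform monotonicity of grad f makes
   f grow at least linearly above its tangent at 0. By reflexivity its linear
   part is (x, p) |-> - s x + p z. Maximality then puts (z, - s) in the graph of
   B, and s turns out to be a subgradient of f at z, i.e. s = grad f z. *)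

Set Implicit Arguments.
Unset Strict Implicit.
Unset Printing Implicit Defensive.
Import Order.TTheory GRing.Theory Num.Theory.
Import numFieldNormedType.Exports.
Local Open Scope classical_set_scope.
Local Open Scope ring_scope.

(** * Algebraic Hahn-Banach separation by maximal cones *)

Section Hahn_Banach.
Context {R : realType} {V : lmodType R}.
Implicit Types (C G : set (V * R^o)) (x y : V * R^o).

Let pairZD (u v : V) (r s t : R) :
  (u, r : R^o) + t *: (v, s : R^o) = (u + t *: v, r + t * s).
Proof. by []. Qed.

(** A pair [(v, r)] is read as a point above [v], so these cones play the role of epigraphs of
    sublinear functions. *)
Let cone G := G 0 /\ forall x y t, 0 <= t -> G x -> G y -> G (x + t *: y).

Let nonneg_at0 G := forall r, G (0, r) -> 0 <= r.

Let maximal_cone C : cone C -> nonneg_at0 C ->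
  exists G, [/\ C `<=` G, cone G, nonneg_at0 G &
    forall G', G `<=` G' -> cone G' -> nonneg_at0 G' -> G' `<=` G].
Proof.
move=> coneC C0.
(* Taking the union with [C] admits the empty chain in Zorn's lemma: its union is empty, and [C]
   itself is a cone. For the same reason [set0] may stand in for a member of the chain below. *)
pose P := [set H | cone (H `|` C) /\ nonneg_at0 (H `|` C)].
have [F FP Ftot|H [[coneH H0] Hmax]] := @Zorn_bigcup _ P.
  have inF z : (\bigcup_(X in F) X `|` C) z ->
      exists X, [/\ P X, F X \/ X = set0 & (X `|` C) z].
    move=> [[X FX Xz]|Cz]; first by exists X; split; [exact: FP|left|left].
    by exists set0; split; [rewrite /P/= set0U|right|right].
  have Fin X : F X \/ X = set0 -> X `|` C `<=` \bigcup_(X in F) X `|` C.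
    move=> [FX|->]; last by rewrite set0U => z Cz; right.
    by move=> z [Xz|Cz]; [left; exists X|right].
  split=> [|r /inF[X [[_ X0] _] /X0]//].
  split=> [|x y t t0 /inF[X [[[_ cX] _] FX] Xx] /inF[Y [[[_ cY] _] FY] Yy]].
    by right; case: coneC.
  have [XY|YX] : X `<=` Y \/ Y `<=` X.
    move: FX FY => [FX|->] [FY|->]; [exact: Ftot|by right|by left|by left].
  - by apply: (Fin Y) => //; apply: cY => //; case: Xx => [/XY|]; [left|right].
  - by apply: (Fin X) => //; apply: cX => //; case: Yy => [/YX|]; [left|right].
exists (H `|` C); split => // G' HG' cG' G'0 z G'z.
have CG' : C `<=` G' by move=> c Cc; apply: HG'; right.
have G'E : G' `|` C = G' by apply/setUidPl.
apply: contrapT => Hz; apply: (Hmax G'); first last.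
  by rewrite /P/= G'E.
split; first by move=> h Hh; apply: HG'; left.
by move=> /(_ z G'z) Hz'; apply: Hz; left.
Qed.

(** The functional is the fibrewise infimum [L] of a maximal cone: maximality makes the infimum
    attained and [L] odd, and an odd sublinear function is linear. *)
Let cone_linear C : cone C -> nonneg_at0 C -> (forall v, exists r, C (v, r)) ->
  exists L : V -> R, linear L /\ forall v r, C (v, r) -> L v <= r.
Proof.
move=> coneC C0 Cdom.
have [G [CG [G00 coneG] G0 Gmax]] := maximal_cone coneC C0.
have Gdom v : exists r, G (v, r) by have [r /CG] := Cdom v; exists r.
have GN v r s : G (v, r) -> G (- v, s) -> 0 <= s + r.
  move=> Gv GNv; apply: G0; have := coneG _ _ _ ler01 GNv Gv.
  by rewrite pairZD scale1r mul1r addNr.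
(* Adjoining the ray through [(v, a)] keeps the fibre over [0] nonnegative: a point there is
   [(u, s) + t (v, a)] with [u = - t v], and scaling by [t^-1] reduces it to the assumption.
   Maximality then puts [(v, a)] in [G]. *)
have GP v a : (forall r, G (- v, r) -> 0 <= r + a) -> G (v, a).
  move=> va; pose w : V * R^o := (v, a).
  pose G' := [set z | exists x t, [/\ G x, 0 <= t & z = x + t *: w]].
  apply: (Gmax G'); last by exists 0, 1; rewrite add0r scale1r.
  - by move=> x Gx; exists x, 0; rewrite scale0r addr0.
  - split; first by exists 0, 0; rewrite scale0r addr0.
    move=> _ _ t t0 [x [a1 [Gx a10 ->]]] [y [a2 [Gy a20 ->]]].
    exists (x + t *: y), (a1 + t * a2).
    split; [exact: coneG|by rewrite addr_ge0 ?mulr_ge0|].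
    by rewrite scalerDr scalerDl scalerA addrACA.
  - move=> r [[u s] [t [Gu t0 [u0 ->]]]].
    have {u0} uE : u = - (t *: v) by apply/eqP; rewrite -addr_eq0 -u0.
    have [t00|tn0] := eqVneq t 0.
      rewrite t00 /= scale0r addr0; apply: G0.
      by rewrite uE t00 scale0r oppr0 in Gu.
    have : G (- v, t^-1 * s).
      have := coneG _ _ t^-1 _ G00 Gu; rewrite invr_ge0 => /(_ t0).
      rewrite pairZD !add0r uE.
      by rewrite -scalerN scalerA mulVf// scale1r.
    move=> /va; rewrite -(pmulr_rge0 (t^-1 * s + a) (x := t)) ?lt0r ?tn0//.
    by rewrite mulrDr mulrA mulfV// mul1r.
pose L v := inf [set r | G (v, r)].
have L_lb v r : G (v, r) -> L v <= r.
  move=> Gv; apply: ge_inf => //; have [s Gs] := Gdom (- v).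
  by exists (- s) => a /= Ga; rewrite -subr_ge0 opprK addrC; apply: GN Gs.
have L_ge v s : G (- v, s) -> - s <= L v.
  move=> Gs; apply: lb_le_inf; first by have [r] := Gdom v; exists r.
  by move=> a /= Ga; rewrite -subr_ge0 opprK addrC; apply: GN Gs.
have LG v : G (v, L v).
  by apply: GP => s /L_ge; rewrite -subr_ge0 opprK addrC.
have LN v : L (- v) = - L v.
  apply/eqP; rewrite eq_le; apply/andP; split; last first.
    by apply: L_ge; rewrite opprK.
  apply: (L_lb); apply: GP => r; rewrite opprK => /L_lb.
  by rewrite subr_ge0.
have Lle t u v : 0 <= t -> L (u + t *: v) <= L u + t * L v.
  by move=> t0; apply: L_lb; exact: coneG (LG u) (LG v).
have Lpos t u v : 0 <= t -> L (u + t *: v) = L u + t * L v.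
  move=> t0; apply/eqP; rewrite eq_le Lle//= -lerN2 -LN.
  by have := Lle t (- u) (- v) t0; rewrite scalerN -opprD !LN mulrN opprD.
exists L; split=> [t u v|v r /CG/L_lb//].
rewrite [in LHS]addrC; transitivity (L v + t * L u); last by rewrite addrC.
have [t0|t0] := leP 0 t; first exact: Lpos.
have := Lpos (- t) v (- u); rewrite oppr_ge0 => /(_ (ltW t0)).
by rewrite scalerN scaleNr opprK LN mulrNN.
Qed.

(** By convexity the nonnegative multiples of points of [C] form a cone, and scaling keeps its fibre
    over [0] nonnegative. *)
Lemma convex_linear_minorant C :
  (forall x y t, 0 <= t <= 1 -> C x -> C y -> C (t *: x + (1 - t) *: y)) ->
  nonneg_at0 C -> (forall v, exists r, C (v, r)) ->
  exists L : V -> R, linear L /\ forall v r, C (v, r) -> L v <= r.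
Proof.
move=> Cconv C0 Cdom.
pose D := [set z | exists x t, [/\ C x, 0 <= t & z = t *: x]].
have CD x : C x -> D x by move=> Cx; exists x, 1; rewrite scale1r.
have [| | |L [Llin LD]] := @cone_linear D.
- split=> [|_ _ t t0 [x [a [Cx a0 ->]]] [y [b [Cy b0 ->]]]].
    by have [r Cr] := Cdom 0; exists (0, r), 0; rewrite scale0r.
  have tb0 : 0 <= t * b by rewrite mulr_ge0.
  have [ab0|abn0] := eqVneq (a + t * b) 0.
    exists x, 0; split => //; rewrite scalerA scale0r.
    have [-> ->] : a = 0 /\ t * b = 0 by split; lra.
    by rewrite !scale0r addr0.
  have ab_gt0 : 0 < a + t * b by rewrite lt0r abn0 addr_ge0.
  (* The sum is a convex combination of [x] and [y] scaled by the total weight [a + t * b]. *)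
  exists (a / (a + t * b) *: x + (1 - a / (a + t * b)) *: y), (a + t * b).
  split; [|exact: ltW|].
    apply: Cconv => //; rewrite ler_pdivrMr// mul1r lerDl tb0 andbT.
    exact: divr_ge0 a0 (ltW ab_gt0).
  rewrite scalerDr !scalerA mulrBr mulr1 mulrCA mulfV// mulr1.
  by rewrite (addrC a) addrK.
- move=> r [[u s] [t [Cu t0 [u0 ->]]]].
  have [->|tn0] := eqVneq t 0; first by rewrite /= scale0r.
  move/esym/eqP: u0; rewrite scaler_eq0 (negbTE tn0)/= => /eqP u0.
  by rewrite u0 in Cu; rewrite /= mulr_ge0//; exact: C0.
- by move=> v; have [r /CD] := Cdom v; exists r.
- by exists L; split => // v r /CD; exact: LD.
Qed.

End Hahn_Banach.

(** * Upper bounds on balls and continuity of linear functionals *)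

Section linear_functionals.
Context {R : realType} {X : normedModType R}.

(** Translating the bound to [0] and applying it to both [h] and [- h] bounds [L] in absolute value
    near [0]. *)
Lemma linear_ub_ball_continuous (L : X -> R) (x0 : X) (r M : R) :
  linear L -> 0 < r -> (forall x, `|x - x0| < r -> L x <= M) -> continuous L.
Proof.
move=> linL r0 LM.
pose l : {linear X -> R} := HB.pack L (GRing.isLinear.Build R X R _ L linL).
have lM h : `|h| < r -> l h <= M - l x0.
  by move=> hr; rewrite lerBrDr -linearD; apply: LM; rewrite addrK.
apply: (@bounded_linear_continuous _ _ _ l).
apply/ex_bound; exists (M - l x0); apply/nbhs_norm0P; exists r => // h /= hr.
by rewrite /= ler_norml lM// lerNl -(raddfN l) lM// normrN.
Qed.

Lemma dual_of_linear (L : X -> R) (x0 : X) (r M : R) :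
  linear L -> 0 < r -> (forall x, `|x - x0| < r -> L x <= M) ->
  exists p : dual X, forall x, p x = L x.
Proof.
move=> linL r0 LM; have cL := linear_ub_ball_continuous linL r0 LM.
by exists (Dual (mem_set (conj linL cL) : L \in continuous_linear X)).
Qed.

End linear_functionals.

(** The open sets where [f] exceeds [n] have empty intersection, so by Baire's theorem one of them
    is not dense and misses a ball. *)
Lemma lower_semicontinuous_ub_ball (R : realType) (X : completeNormedModType R)
    (f : X -> R) :
  lower_semicontinuous (EFin \o f) ->
  exists (x0 : X) (r M : R), 0 < r /\ forall x, `|x - x0| < r -> f x <= M.
Proof.
move=> /lower_semicontinuousP fo.
pose F (n : nat) := [set x : X | (n%:R%:E < (EFin \o f) x)%E].
have /existsNP[n /existsNP[U /not_implyP[[x Ux] /not_implyP[oU UF]]]] :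
    ~ forall n, dense (F n).
  move=> dF; have [||x [_ Fx]] := @Baire R X F _ setT _ openT.
  - by move=> n; split; [exact: fo|exact: dF].
  - by exists 0.
  have := Fx (Num.truncn `|f x|).+1 Logic.I.
  rewrite /F/= lte_fin ltNge => /negP; apply.
  by rewrite (le_trans (ler_norm _))// ltW// truncnS_gt.
have /nbhs_normP[r /= r0 rU] : nbhs x U by exact: open_nbhs_nbhs.
exists x, r, n%:R; split => // y xy; rewrite leNgt; apply/negP => nfy.
apply: UF; exists y; split; last by rewrite /F/= lte_fin.
by apply: rU; rewrite /= distrC.
Qed.

Lemma convex_functionP (R : realType) (X : lmodType R) (f : X -> R) :
  convex_function [set: convex_lmodType X] f ->
  forall (x y : X) (t : R), 0 <= t <= 1 ->
    f (t *: x + (1 - t) *: y) <= t * f x + (1 - t) * f y.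
Proof.
move=> cf x y t /andP[t0 t1].
by have := cf (Itv01 t0 t1) x y; rewrite !inE => /(_ Logic.I Logic.I).
Qed.

(** * Gateaux derivatives and subgradients *)

Section gateaux.
Context {R : realType} {X : normedModType R}.
Implicit Types (f : X -> R) (x y h : X) (p q : dual X).

(** The right-hand limit lets the two bounds below be checked for small positive [t] alone. *)
Let gateaux_cvg f x p h : gateaux_derivative f x p ->
  (fun t : R => t^-1 * (f (t *: h + x) - f x)) @ 0^'+ --> p h.
Proof. by move=> /(_ h)[fxh <-]; apply: cvg_dnbhs_at_right; exact: fxh. Qed.

Lemma gateaux_derivative_le f x p h (M : R) : gateaux_derivative f x p ->
  (forall t, 0 < t < 1 -> f (t *: h + x) - f x <= t * M) -> p h <= M.
Proof.
move=> /gateaux_cvg fp fM; apply: (cvgr_to_le (fp h)); near=> t.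
have t0 : 0 < t by near: t; exact: nbhs_right_gt.
rewrite ler_pdivrMl//; apply: fM; rewrite t0/=.
by near: t; apply: nbhs_right_lt.
Unshelve. all: end_near. Qed.

Lemma gateaux_derivative_ge f x p h (M : R) : gateaux_derivative f x p ->
  (forall t, 0 < t < 1 -> t * M <= f (t *: h + x) - f x) -> M <= p h.
Proof.
move=> /gateaux_cvg fp fM; apply: (cvgr_to_ge (fp h)); near=> t.
have t0 : 0 < t by near: t; exact: nbhs_right_gt.
rewrite ler_pdivlMl//; apply: fM; rewrite t0/=.
by near: t; apply: nbhs_right_lt.
Unshelve. all: end_near. Qed.

(** By convexity the difference quotients along the segment from [x] to [y] are at most
    [f y - f x]. *)
Lemma convex_gateaux_subgradient f x p :
  convex_function [set: convex_lmodType X] f -> gateaux_derivative f x p ->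
  forall y, p (y - x) <= f y - f x.
Proof.
move=> cf fp y; apply: (gateaux_derivative_le fp) => t /andP[t0 t1].
have -> : t *: (y - x) + x = t *: y + (1 - t) *: x.
  by rewrite scalerBr scalerBl scale1r -addrA (addrC x) addrA.
have : 0 <= t <= 1 by rewrite !ltW.
by move=> /(convex_functionP cf y x); lra.
Qed.

(** A subgradient lies below the one-sided quotients, so [q h <= p h]; replacing [h] by [- h] gives
    equality. *)
Lemma subgradient_gateaux_unique f x p q : gateaux_derivative f x p ->
  (forall y, q (y - x) <= f y - f x) -> q = p.
Proof.
move=> fp fq.
have qp h : q h <= p h.
  apply: (gateaux_derivative_ge fp) => t _.
  by have := fq (t *: h + x); rewrite addrK linearZ.
apply/val_inj/funext => h /=; apply/eqP; rewrite eq_le qp/=.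
by rewrite -lerN2 -!linearN qp.
Qed.

Lemma gradientP f : gateaux_differentiable f ->
  forall x, gateaux_derivative f x (gradient f x).
Proof. by move=> fG x; have := xgetPex 0 (fG x). Qed.

End gateaux.

Section pairing.
Context {R : realType} {X : normedModType R}.
Implicit Types (x y : X) (p q : dual X).

Lemma dualNE p x : (- p) x = - p x. Proof. by []. Qed.

Lemma dualBE p q x : (p - q) x = p x - q x. Proof. by []. Qed.

Lemma dual_scale p (t : R) x : p (t *: x) = t * p x.
Proof. exact: linearZ. Qed.

(** Expands the pairing of differences into scalar terms that [lra] can handle. *)
Lemma dualBB p q x y : (p - q) (x - y) = p x - p y - (q x - q y).
Proof.
by rewrite dualBE !linearB/=; ring.
Qed.

End pairing.

(** * Fenchel-Young inequalities and convexity of the conjugate *)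

Section conjugate.
Context {R : realType} {X : normedModType R} (f : X -> R).
Context (f_fin : forall p, conjugate f p \is a fin_num).
Implicit Types p q : dual X.
Let g := fine \o conjugate f.

Lemma conjugate_ge p x : p x - f x <= g p.
Proof.
by rewrite -lee_fin /g/= fineK//; apply: ereal_sup_ubound; exists x.
Qed.

Lemma conjugate_le p M : (forall x, p x - f x <= M) -> g p <= M.
Proof.
move=> pM; rewrite -lee_fin /g/= fineK//.
by apply: ge_ereal_sup => _ [x _ <-]; rewrite lee_fin.
Qed.

Lemma conjugate_convex p q (t : R) : 0 <= t <= 1 ->
  g (t *: p + (1 - t) *: q) <= t * g p + (1 - t) * g q.
Proof.
move=> /andP[t0 t1]; apply: conjugate_le => x; rewrite dualDE !dualZE.
have := ler_wpM2l t0 (conjugate_ge p x).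
have t10 : 0 <= 1 - t by rewrite subr_ge0.
by have := ler_wpM2l t10 (conjugate_ge q x); lra.
Qed.

(** With [conjugate_ge], this is the equality case of Fenchel-Young at a subgradient. *)
Lemma conjugate_gradient_le x p :
  (forall y, p (y - x) <= f y - f x) -> g p <= p x - f x.
Proof.
by move=> px; apply: conjugate_le => y; have := px y; rewrite linearB/=; lra.
Qed.

End conjugate.

(** * Zeros of the sum of a gradient and a maximally monotone operator *)

Section surjectivity.
Context {R : realType} {X : completeNormedModType R}.
Implicit Types (a x z : X) (p q s : dual X) (B : X -> set (dual X)).

(** Otherwise adjoining [(z, q)] to the graph would give a properly larger monotone operator. *)
Lemma maximally_monotone_related B : maximally_monotone B ->
  forall z q, (forall a p, B a p -> 0 <= (p - q) (a - z)) -> B z q.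
Proof.
move=> [Bmon Bmax] z q zq; apply: contrapT => nBzq.
pose B' a := B a `|` [set p | a = z /\ p = q].
have B'mon : monotone_op B'.
  move=> x1 x2 p1 p2 [B1|[-> ->]] [B2|[-> ->]].
  - exact: Bmon.
  - exact: zq.
  - by have := zq _ _ B2; rewrite -(opprB x2) -(opprB p2) linearN/= opprK.
  - by rewrite subrr.
apply: (Bmax _ B'mon); split; first by move=> [a p] /= Bap; left.
by move=> sub; apply/nBzq/(sub (z, q)); right.
Qed.

(** Maximality is assumed in its related-point form, which passes easily to the translate of
    [lambda A] used later. *)
Lemma monotone_op_add_gradient_zero B (f : X -> R) :
  reflexive_space X -> monotone_op B ->
  (forall z q, (forall a p, B a p -> 0 <= (p - q) (a - z)) -> B z q) ->
  lower_semicontinuous (EFin \o f) ->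
  convex_function [set: convex_lmodType X] f -> gateaux_differentiable f ->
  (forall p, conjugate f p \is a fin_num) ->
  (exists (p0 : dual X) (r M : R), 0 < r /\
     forall p, `|p - p0| < r -> fine (conjugate f p) <= M) ->
  exists z, B z (- gradient f z).
Proof.
move=> reflX Bmon Bmax flsc fconv fG ffin [p0 [r0 [M0 [r00 gM0]]]].
pose g := fine \o conjugate f.
(* An empty graph would be vacuously related to [(0, 0)], which would then belong to it. *)
have [a0 [q0 Ba0]] : exists a p, B a p.
  apply: contrapT => nB; apply: (nB); exists 0, 0; apply: Bmax => a p Bap.
  by exfalso; apply: nB; exists a, p.
pose E : lmodType R := (X * dual X)%type.
(* [K x q r] says that r bounds the Fitzpatrick function of [B] at (x, q). *)
pose K x q (r : R) := forall a p, B a p -> p x + q a - p a <= r.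
have KB a p : B a p -> K a p (p a).
  move=> Bap b q Bbq /=; have := Bmon _ _ _ _ Bap Bbq.
  by rewrite dualBB; lra.
(* If [r < q x], then [(x, q)] is related to the graph, hence in it, and testing the bound at
   [(x, q)] itself gives a contradiction. *)
have Kge x q r : K x q r -> q x <= r.
  move=> Kr; rewrite leNgt; apply/negP => rq.
  have /Kr : B x q; last by rewrite addrK leNgt rq.
  by apply: Bmax => a p /Kr; rewrite dualBB; lra.
have Kconv x q r x' q' r' (t : R) : 0 <= t <= 1 -> K x q r -> K x' q' r' ->
    K (t *: x + (1 - t) *: x') (t *: q + (1 - t) *: q') (t * r + (1 - t) * r').
  move=> /andP[t0 t1] Kr Kr' a p Bap; have t10 : 0 <= 1 - t by rewrite subr_ge0.
  have := ler_wpM2l t0 (Kr _ _ Bap); have := ler_wpM2l t10 (Kr' _ _ Bap).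
  by rewrite dualDE !dualZE linearD/= !dual_scale; lra.
(* A linear minorant of [C] separates the two convex functions, because the base point is the
   difference of [(y, - q)] and [(x, p)]. Over [0] this forces [y = x] and [p = - q], where [Kge]
   and Fenchel-Young give nonnegativity. *)
pose C := [set z : E * R^o | exists x p y q r, [/\ K x p r,
  r + f y + g q <= z.2 & z.1 = (y - x, - q - p)]].
have Cconv (z w : E * R^o) (t : R) :
    0 <= t <= 1 -> C z -> C w -> C (t *: z + (1 - t) *: w).
  move=> t01 [x [p [y [q [r [Kr rz zE]]]]]].
  move=> [x' [p' [y' [q' [r' [Kr' rw wE]]]]]].
  have /andP[t0 t1] := t01; have t10 : 0 <= 1 - t by rewrite subr_ge0.
  exists (t *: x + (1 - t) *: x'), (t *: p + (1 - t) *: p').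
  exists (t *: y + (1 - t) *: y'), (t *: q + (1 - t) *: q').
  exists (t * r + (1 - t) * r'); split; first exact: Kconv.
    have fle := convex_functionP fconv y y' t01.
    have gle := conjugate_convex ffin q q' t01.
    apply: (@le_trans _ _ (t * z.2 + (1 - t) * w.2)); last by [].
    have := ler_wpM2l t0 rz; have := ler_wpM2l t10 rw.
    rewrite -/g in gle; lra.
  transitivity (t *: z.1 + (1 - t) *: w.1); first by [].
  rewrite zE wE; congr pair => /=.
    by rewrite !scalerBr opprD addrACA.
  by rewrite !scalerBr !scalerN !opprD addrACA.
have [||L [linL CL]] := @convex_linear_minorant _ _ C Cconv.
- move=> s [x [p [y [q [r [/Kge pr rs]]]]]] [].
  move=> /esym/eqP; rewrite subr_eq0 => /eqP yx.
  move=> /esym/eqP; rewrite subr_eq0 => /eqP qp.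
  have px : p x = - q x by rewrite -qp.
  have := conjugate_ge ffin q x; rewrite -/(g q).
  by move: rs; rewrite yx px /= in pr *; lra.
- move=> [v1 v2]; exists (q0 a0 + f (v1 + a0) + g (- (v2 + q0))).
  exists a0, q0, (v1 + a0), (- (v2 + q0)), (q0 a0).
  split => //; first exact: KB.
  by rewrite opprK !addrK.
pose l : {linear E -> R} := HB.pack L (GRing.isLinear.Build R E R _ L linL).
have fitz a p x q : B a p ->
    l (x, 0) - l (a, 0) - l (0, q) - l (0, p) <= p a + f x + g q.
  move=> Bap; rewrite -!(raddfB l); apply: (CL _ (p a + f x + g q)).
  exists a, p, x, q, (p a); split=> //; first exact: KB.
  by congr pair => /=; rewrite ?subr0 ?sub0r.
have linl1 : linear (fun x => l (x, 0)).
  move=> t x y; rewrite -linearP; congr (l _).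
  by congr pair => /=; rewrite scaler0 addr0.
have linl2 : linear (fun q : dual X => - l (0, q)).
  move=> t x y; rewrite scalerN -opprD -linearP; congr (- l _).
  by congr pair => /=; rewrite scaler0 addr0.
(* With [q := 0], [fitz] bounds [l (x, 0)] above on a ball where [f] is bounded; with [x := 0] it
   does the same for [- l (0, q)] and [g]. *)
have [s sE] : exists s : dual X, forall x, s x = l (x, 0).
  have [x0 [r [M [rgt0 fM]]]] := lower_semicontinuous_ub_ball flsc.
  apply: (dual_of_linear (x0 := x0) (r := r)
    (M := q0 a0 + g 0 + l (a0, 0) + l (0, 0) + l (0, q0) + M)) linl1 rgt0 _.
  by move=> x /fM fx; have := fitz _ _ x 0 Ba0; lra.
have [F FE] : exists F : dual (dual X), forall q, F q = - l (0, q).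
  apply: (dual_of_linear (x0 := p0) (r := r0)
    (M := q0 a0 + f 0 + l (a0, 0) - l (0, 0) + l (0, q0) + M0)) linl2 r00 _.
  by move=> q /gM0 gq; have := fitz _ _ 0 q Ba0; rewrite /g/=; lra.
have [z zE] := reflX F.
(* For [q := gradient f z], the bound [g q <= q z - f z] cancels the terms in [q] from [fitz]. *)
have {linl1 linl2} key a p x : B a p ->
    s x - s a + p z + f z <= p a + f x.
  move=> Bap; have := fitz _ _ x (gradient f z) Bap.
  have := conjugate_gradient_le ffin
    (convex_gateaux_subgradient fconv (gradientP fG z)).
  rewrite -/(g _) -!sE; have := zE (gradient f z); have := zE p.
  by rewrite !FE; lra.
(* Taking [x := z] in [key] shows that [(z, - s)] is related to the graph. Feeding this new graph
   point back into [key] makes [s] a subgradient of [f] at [z]. *)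
have Bzs : B z (- s).
  apply: Bmax => a p /(key _ _ z); rewrite dualBB !dualNE; lra.
exists z; suff <- : s = gradient f z by [].
apply: subgradient_gateaux_unique (gradientP fG z) _ => y.
by have := key _ _ y Bzs; rewrite linearB !dualNE/=; lra.
Qed.

End surjectivity.

(** * Order properties of a premodulus *)

Section premodulus.
Context {R : realType} (mut : R -> R).
Context (mutP : premodulus mut).

Lemma premodulus_le s t : 0 <= s -> s <= t -> mut s <= mut t.
Proof.
move=> s0; rewrite le_eqVlt => /predU1P[->//|st]; apply/ltW/mutP.1 => //.
- by rewrite in_itv/= s0.
- by rewrite in_itv/= (le_trans s0)// ltW.
Qed.

Lemma premodulus_ge0 t : 0 <= t -> 0 <= mut t.
Proof.
have [_ [mut0 _ _]] := mutP; move=> t0.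
by have := mut0 t; rewrite /= !in_itv/= !andbT; exact.
Qed.

Lemma premodulus_gt0 t : 0 < t -> 0 < mut t.
Proof.
move=> t0; apply: (le_lt_trans (premodulus_ge0 (lexx 0))).
by apply: mutP.1 => //; rewrite in_itv/= andbT// ltW.
Qed.

End premodulus.

(** * Sums and inverses of uniformly monotone operators *)

Section uniformly_monotone_sum.
Context {R : realType} {X : normedModType R}.
Implicit Types (A B : X -> set (dual X)) (mu mut : R -> R).

Lemma op_addC A B : op_add A B = op_add B A.
Proof.
by apply/funext => x; apply/seteqP; split => p [u Fu [v Gv <-]];
  exists v => //; exists u => //; rewrite addrC.
Qed.

Lemma uniformly_monotone_addl A B mu mut : monotone_op A ->
  uniformly_monotone_with mu mut B ->
  uniformly_monotone_with mu mut (op_add A B).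
Proof.
move=> Amon [mutP muE Bmu]; split => // y1 y2 _ _
  [a1 A1 [b1 B1 <-]] [a2 A2 [b2 B2 <-]].
have := Amon _ _ _ _ A1 A2; have := Bmu _ _ _ _ B1 B2.
by rewrite !dualBB !dualDE; lra.
Qed.

Lemma monotone_op_scale A (a : R) : 0 < a -> monotone_op A ->
  monotone_op (op_scale a A).
Proof.
move=> a0 Amon x1 x2 _ _ [p1 A1 <-] [p2 A2 <-].
have := mulr_ge0 (ltW a0) (Amon _ _ _ _ A1 A2).
by rewrite !dualBB !dualZE; lra.
Qed.

(** The pairing is at most the product of the two norms; dividing by the positive distance leaves
    [mut]. *)
Lemma uniformly_monotone_dist_le A mu mut : uniformly_monotone_with mu mut A ->
  forall x1 x2 p1 p2, A x1 p1 -> A x2 p2 -> x1 != x2 ->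
  mut `|x1 - x2| <= `|p1 - p2|.
Proof.
move=> [mutP muE Amu] x1 x2 p1 p2 A1 A2 x12.
have d0 : 0 < `|x1 - x2| by rewrite normr_gt0 subr_eq0.
rewrite -(ler_pM2l d0) -muE// (le_trans (Amu _ _ _ _ A1 A2))//.
rewrite mulrC (le_trans (ler_norm _))//.
exact: (ler_dual_norm (p1 - p2)).
Qed.

Lemma uniformly_monotone_inv_unique A mu mut :
  uniformly_monotone_with mu mut A ->
  forall x1 x2 p, A x1 p -> A x2 p -> x1 = x2.
Proof.
move=> Amu x1 x2 p A1 A2; apply/eqP/contraT => x12.
have := uniformly_monotone_dist_le Amu A1 A2 x12.
have [mutP _ _] := Amu.
by rewrite subrr normr0 leNgt premodulus_gt0// normr_gt0 subr_eq0.
Qed.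

(** The radius [mut e] answers [e]: values at distance at least [e] would force the arguments to be
    at least [mut e] apart. *)
Lemma uniformly_monotone_inv_continuous A mu mut (T : dual X -> X) :
  uniformly_monotone_with mu mut A -> (forall w, A (T w) w) -> continuous T.
Proof.
move=> Amu AT w; have [mutP _ _] := Amu.
apply/(@cvgrPdist_lt _ _ _ (nbhs w)) => e e0; near=> w'.
have wlt : `|w - w'| < mut e.
  by near: w'; apply: cvgr_dist_lt => //; exact: premodulus_gt0.
rewrite ltNge; apply/negP => eT.
have TT : T w != T w'.
  by apply/eqP => Tw; move: eT; rewrite Tw subrr normr0 leNgt e0.
have := uniformly_monotone_dist_le Amu (AT w) (AT w') TT.
by rewrite leNgt (lt_le_trans wlt)// premodulus_le// ltW.
Unshelve. all: end_near. Qed.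

Lemma uniformly_monotone_power_inv_hoelder A mut (beta rho : R)
    (T : dual X -> X) :
  0 < beta -> 1 < rho ->
  uniformly_monotone_with (fun t => beta * t `^ rho) mut A ->
  (forall w, A (T w) w) -> hoelder_continuous (1 / (rho - 1)) T.
Proof.
move=> beta0 rho1 Amu AT; have rho0 : 0 < rho - 1 by rewrite subr_gt0.
split; first by rewrite divr_gt0.
exists (beta^-1 `^ (1 / (rho - 1))); first exact: powR_ge0.
move=> w1 w2; have [->|TT] := eqVneq (T w1) (T w2).
  by rewrite subrr normr0 mulr_ge0// powR_ge0.
have d0 : 0 < `|T w1 - T w2| by rewrite normr_gt0 subr_eq0.
have [_ muE _] := Amu.
have := uniformly_monotone_dist_le Amu (AT w1) (AT w2) TT.
(* Multiplying back by the distance [d] recovers the explicit modulus; cancelling one factor [d]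
   then bounds [d] to the power [rho - 1] by [beta^-1] times the distance of the arguments. *)
rewrite -(ler_pM2l d0) -muE//; set d := `|_| in d0 *.
rewrite -{1}(subrK 1 rho) powRD; last by rewrite (gt_eqF d0) implybT.
rewrite powRr1 ?(ltW d0)// mulrA [leRHS]mulrC ler_pM2r// mulrC.
rewrite -ler_pdivlMr// mulrC => dle.
rewrite -powRM ?invr_ge0 ?(ltW beta0)//.
have -> : d = (d `^ (rho - 1)) `^ (1 / (rho - 1)).
  by rewrite -powRrM mulrC divfK ?gt_eqF// powRr1// ltW.
apply: ge0_ler_powR => //; first by rewrite divr_ge0// ltW.
- by rewrite nnegrE powR_ge0.
- by rewrite nnegrE mulr_ge0// invr_ge0 ltW.
Qed.

End uniformly_monotone_sum.

(** Uniform monotonicity makes [f] outgrow its tangent at [0] at least linearly, which absorbs small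
    perturbations of the slope [gradient f 0]. *)
Lemma conjugate_ub_ball (R : realType) (X : normedModType R) (f : X -> R) :
  convex_function [set: convex_lmodType X] f -> gateaux_differentiable f ->
  (forall p, conjugate f p \is a fin_num) ->
  uniformly_monotone (op_fun (gradient f)) ->
  exists (p0 : dual X) (r M : R), 0 < r /\
    forall p, `|p - p0| < r -> fine (conjugate f p) <= M.
Proof.
move=> fconv fG ffin [mu [mut [mutP muE fmu]]].
have c0 : 0 < mut 1 by exact: premodulus_gt0.
pose G := gradient f; pose c := mut 1.
(* Since [y] has twice the norm of [h] below, the radius [c / 2] yields the error [c * |h|], and
   [mu |h|] compensates for it up to [c]. *)
exists (G 0), (c / 2), (c - f 0); split; first by rewrite divr_gt0.
move=> p pc; apply: conjugate_le => // y.
(* Subgradient inequalities from [0] to the midpoint [h] and from [h] to [y] leave the gain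
   [G h h - G 0 h], which is at least [mu |h|]. *)
pose h : X := 2^-1 *: y.
have yE : y = h + h by rewrite -mulr2n -scaler_nat scalerA mulfV ?scale1r.
have sub x := convex_gateaux_subgradient fconv (gradientP fG x).
have f1 : G h h <= f y - f h.
  by have := sub h y; rewrite [in X in X <= _]yE addrK.
have f2 : G 0 h <= f h - f 0 by have := sub 0 h; rewrite subr0.
have f3 : mu `|h| <= G h h - G 0 h.
  by have := fmu h 0 _ _ erefl erefl; rewrite subr0 dualBE.
have f4 : p y - G 0 y <= c * `|h|.
  rewrite (le_trans (ler_norm _))// (le_trans (ler_dual_norm (p - G 0) y))//.
  rewrite /h normrZ gtr0_norm ?invr_gt0// mulrA ler_wpM2r//.
  exact: ltW pc.
have f5 : c * `|h| - mu `|h| <= c.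
  rewrite muE//; have [h1|h1] := leP 1 `|h|.
    have := premodulus_le mutP ler01 h1; rewrite -/c => cle.
    by have := ler_wpM2l (normr_ge0 h) cle; have := c0; rewrite -/c; lra.
  have := ler_wpM2l (ltW c0) (ltW h1); rewrite -/c mulr1.
  by have := mulr_ge0 (normr_ge0 h) (premodulus_ge0 mutP (normr_ge0 h)); lra.
have f6 : G 0 y = G 0 h + G 0 h by rewrite [in LHS]yE linearD.
lra.
Qed.

Lemma gradient_add_monotone_surjective (R : realType)
    (X : completeNormedModType R) (A : X -> set (dual X)) (lambda : R)
    (f : X -> R) :
  reflexive_space X -> maximally_monotone A -> 0 < lambda -> fully_legendre f ->
  uniformly_monotone (op_fun (gradient f)) ->
  forall w, exists x, op_add (op_fun (gradient f)) (op_scale lambda A) x w.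
Proof.
move=> reflX Amax lambda0 [flsc fconv fG ffin _] fmon w.
pose B x := [set p - w | p in op_scale lambda A x].
have [|z q zq|z [_ [p Azp <-] pw]] := monotone_op_add_gradient_zero
  reflX _ _ flsc fconv fG ffin (conjugate_ub_ball fconv fG ffin fmon) (B := B).
- move=> x1 x2 _ _ [p1 A1 <-] [p2 A2 <-]; rewrite opprB addrA subrK.
  exact: (monotone_op_scale lambda0 Amax.1).
(* Scaling by [lambda] and shifting by [w] turn the relation of [(z, q)] to [B] into one of
   [(z, lambda^-1 (q + w))] to [A]. *)
- exists (q + w); last by rewrite addrK.
  exists (lambda^-1 *: (q + w)); last first.
    by rewrite scalerA mulfV ?gt_eqF// scale1r.
  apply: (maximally_monotone_related Amax) => a p Aap.
  rewrite -(pmulr_rge0 _ lambda0) -dualZE scalerBr scalerA mulfV ?gt_eqF//.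
  rewrite scale1r opprD (addrC (- q)) addrA; apply: zq.
  by exists (lambda *: p) => //; exists p.
exists z; exists (gradient f z) => //; exists (lambda *: p); first by exists p.
by apply/eqP; rewrite -subr_eq0 -addrA pw addrN.
Qed.

(** * Continuity of inverses and resolvents *)

Lemma single_valued_op_fun (U V : Type) (F : U -> set V) :
  single_valued F -> exists T : U -> V, F = op_fun T.
Proof.
move=> Fsv; have [T FT] := choice Fsv; exists T.
apply/funext => u; apply/seteqP; split => v /=.
  by move=> /(FT u).2 <-.
by move=> ->; exact: (FT u).1.
Qed.

Theorem corollary6p4 (R : realType) :
  (forall (X : normedModType R) (A B : X -> set (dual X)),
     monotone_op A -> uniformly_monotone B ->
     single_valued (op_inv (op_add A B)) ->
     op_continuous (op_inv (op_add A B))) /\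
  (forall (X : completeNormedModType R) (A : X -> set (dual X))
     (lambda rho : R) (f : X -> R),
     reflexive_space X -> maximally_monotone A -> 0 < lambda ->
     fully_legendre f ->
     uniformly_monotone_power rho (op_fun (gradient f)) ->
     op_hoelder_continuous (1 / (rho - 1))
       (op_inv (op_add (op_fun (gradient f)) (op_scale lambda A))) /\
     (continuous (gradient f) ->
      op_continuous (resolvent f (op_scale lambda A)))).
Proof.
split=> [X A B Amon [mu [mut Bmu]] ABsv|].
  have [T TE] := single_valued_op_fun ABsv; exists T => //.
  have ABmu := uniformly_monotone_addl Amon Bmu.
  apply: (uniformly_monotone_inv_continuous ABmu) => w.
  by have : op_inv (op_add A B) w (T w) by rewrite TE.
move=> X A lambda rho f reflX Amax lambda0 fleg [rho1 [beta beta0 [mut fmu]]].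
have fum : uniformly_monotone (op_fun (gradient f)).
  by exists (fun t => beta * t `^ rho), mut.
have surj := gradient_add_monotone_surjective reflX Amax lambda0 fleg fum.
have Smu := uniformly_monotone_addl (monotone_op_scale lambda0 Amax.1) fmu.
rewrite op_addC in Smu.
have [|T TE] := @single_valued_op_fun _ _
    (op_inv (op_add (op_fun (gradient f)) (op_scale lambda A))).
  move=> w; have [x Sx] := surj w; exists x; split=> // x' Sx'.
  exact: uniformly_monotone_inv_unique Smu _ _ _ Sx Sx'.
have ST w : op_add (op_fun (gradient f)) (op_scale lambda A) (T w) w.
  have : op_inv (op_add (op_fun (gradient f)) (op_scale lambda A)) w (T w).
    by rewrite TE.
  by [].
split.
  by exists T => //; exact: uniformly_monotone_power_inv_hoelder Smu ST.
(* The resolvent is the single-valued inverse composed with the gradient. *)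
move=> cf; exists (T \o gradient f); first by rewrite /resolvent TE.
move=> x; apply: continuous_comp; first exact: cf.
exact: uniformly_monotone_inv_continuous Smu ST _.
Qed.
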